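(* Let $X$ be a real Banach space with norm $\|\cdot\|$, let $C^0([0,1];X)$ be the space of continuous mappings from $[0,1]$ to $X$, and let $\Phi:X\to\mathbb{R}$ be a locally Lipschitz functional. For $z_0,z_1\in X$ define $$\Gamma:=\{c\in C^0([0,1];X): c(0)=z_0,\ c(1)=z_1\},\qquad \gamma:=\inf_{c\in\Gamma}\max_{0\le t\le 1}\Phi(c(t)),$$ and set $\Phi_\gamma:=\{x\in X:\Phi(x)\ge\gamma\}$. If $F\subset X$ is a closed and norm-bounded subset such that $F\cap\Phi_\gamma$ separates $z_0$ and $z_1$, then there exists a sequence $\{x_n\}\subset X$ such that $$d(x_n,F)\to 0,\qquad \Phi(x_n)\to\gamma,\qquad (1+\|x_n\|)\min_{y^*\in\partial\Phi(x_n)}\|y^*\|\to 0 .$$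
   Context: $d(x,F):=\inf_{y\in F}\|x-y\|$ is the norm distance from $x$ to $F$. For a locally Lipschitz $\Phi:X\to\mathbb{R}$, the generalized directional derivative at $x$ along $v$ is $\Phi^0(x,v):=\limsup_{w\to x,\ t\downarrow 0}\frac{\Phi(w+tv)-\Phi(w)}{t}$, and the Clarke generalized gradient is $\partial\Phi(x):=\{x^*\in X^*:\langle x^*,v\rangle\le\Phi^0(x,v)\ \forall v\in X\}$; $\|y^*\|$ for $y^*\in X^*$ is the dual norm. A closed set $H\subset X$ separates $z_0$ and $z_1$ if $z_0,z_1\in X\setminus H$ lie in different connected components of $X\setminus H$ (equivalently, $X\setminus H=\Omega_0\cup\Omega_1$ with $\Omega_0,\Omega_1$ disjoint open sets, $z_0\in\Omega_0$, $z_1\in\Omega_1$). *)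

(* Defs.v *)
From HB Require Import structures.
From mathcomp Require Import all_boot all_order all_algebra.
From mathcomp Require Import all_classical all_reals all_analysis.

Set Implicit Arguments.
Unset Strict Implicit.
Unset Printing Implicit Defensive.

Import Order.TTheory GRing.Theory Num.Theory.
Import numFieldNormedType.Exports.

Local Open Scope classical_set_scope.
Local Open Scope ring_scope.

(* Unlike [sup] and [inf], [is_max] and [is_min] assert attainment. *)
Definition is_max {R : realType} (A : set R) (m : R) : Prop :=
  A m /\ ubound A m.

Definition is_min {R : realType} (A : set R) (m : R) : Prop :=
  A m /\ lbound A m.

Section NormedSpace.
Context {R : realType} {X : normedModType R}.

(* [inf] is real valued and [inf set0 = 0], so this is the usual distance
   only for nonempty [F]; a set one of whose subsets separates two points
   is nonempty, since [X] is connected. *)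
Definition dist (x : X) (F : set X) : R := inf [set `|x - y| | y in F].

Definition separates (H : set X) (z0 z1 : X) : Prop :=
  [/\ closed H, (~` H) z0, (~` H) z1 &
      connected_component (~` H) z0 <> connected_component (~` H) z1].

Definition locally_lipschitz (Phi : X -> R) : Prop :=
  forall x : X, exists2 U, nbhs x U & [lipschitz (Phi : X -> R^o) y | y in U].

(* A path is a function on all of [R] of which only the restriction to
   [[0, 1]] matters. *)
Definition paths (z0 z1 : X) : set (R -> X) :=
  [set c : R -> X | [/\ {within `[0, 1], continuous c}, c 0 = z0 & c 1 = z1]].

Definition minimax (Phi : X -> R) (z0 z1 : X) : R :=
  inf [set m | exists2 c, paths z0 z1 c &
                 is_max [set Phi (c t) | t in `[0, 1]] m].

(* The limsup is taken in [\bar R]; it is finite when [Phi] is locally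
   Lipschitz. The pair [p] is [(w, t)]. *)
Definition clarke_derivative (Phi : X -> R) (x v : X) : \bar R :=
  limf_esup
    (fun p : X * R => ((Phi (p.1 + p.2 *: v) - Phi p.1) / p.2)%:E)
    (filter_prod (nbhs x) (0 : R)^'+).

Definition topological_dual : set {linear X -> R^o} := [set f | continuous f].

Definition dual_norm (f : {linear X -> R^o}) : R :=
  sup [set `|f v| | v in [set v | `|v| <= 1]].

Definition clarke_gradient (Phi : X -> R) (x : X) : set {linear X -> R^o} :=
  [set f | topological_dual f /\
           forall v, ((f v : R)%:E <= clarke_derivative Phi x v)%E].

End NormedSpace.

(* Main.v *)
(** Put [H = F /\ {Phi >= gamma}]; every path from [z0] to [z1] meets [H].
    Since [F] is bounded, it suffices to find, for each small [e], a point
    within [3e/2] of [H], at level at most [gamma + 5e^2/4], whose Clarke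
    gradient has an element of norm at most [3e/2]. Following Ghoussoub and
    Preiss, add to [Phi] the bump [max(0, e^2 - e d(x, H))] and start from a
    path [c] whose maximum is below [gamma + e^2/4]. Ekeland's principle,
    applied to the paths that agree with [c] wherever [d(c t, H) >= e], gives
    a path [k] that almost minimizes the maximum of the perturbed functional.
    That maximum is at least [gamma + e^2], so it is only attained where [k] is
    near [H]. If at all such points some unit direction had Clarke derivative
    below [-3e/2], a continuous selection of these directions would deform [k]
    into a path contradicting the choice of [k]. By the Hahn-Banach theorem,
    a lower bound on the Clarke derivative over the unit ball is a bound on
    the least norm in the Clarke gradient. *)

Require Import Defs.
From HB Require Import structures.
From mathcomp Require Import all_boot all_order all_algebra.
From mathcomp Require Import all_classical all_reals all_analysis.
From mathcomp Require Import lra.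

Set Implicit Arguments.
Unset Strict Implicit.
Unset Printing Implicit Defensive.

Import Order.TTheory GRing.Theory Num.Theory.
Import numFieldNormedType.Exports.

Local Open Scope classical_set_scope.
Local Open Scope ring_scope.

(** * Sublinear functionals and the Hahn-Banach theorem *)

Section Sublinear.
Context {R : realType} {V : lmodType R}.
Implicit Types (p q : V -> R) (x y : V) (K : set (V * R)).

Definition sublinear q : Prop :=
  (forall x y, q (x + y) <= q x + q y) /\
  (forall t x, 0 <= t -> q (t *: x) <= t * q x).

Lemma sublinear0 q : sublinear q -> q 0 = 0.
Proof.
move=> [qD qZ]; apply/le_anti/andP; split.
  by have := qZ 0 0 (lexx 0); rewrite scaler0 mul0r.
by have := qD 0 0; rewrite addr0; lra.
Qed.

Lemma sublinearN q x : sublinear q -> - q (- x) <= q x.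
Proof.
move=> qs; have := qs.1 x (- x); rewrite subrr (sublinear0 qs); lra.
Qed.

Definition convex_cone K : Prop :=
  [/\ K (0, 0), forall z w, K z -> K w -> K (z.1 + w.1, z.2 + w.2) &
      forall t z, 0 <= t -> K z -> K (t *: z.1, t * z.2)].

(* The infimal convolution of [q] with the function whose epigraph is [K],
   up to reflection of the first coordinate. *)
Definition cone_inf q K x : R := inf [set q (x + z.1) + z.2 | z in K].

Section ConeInf.
Variables (q : V -> R) (K : set (V * R)).
Hypotheses (qs : sublinear q) (Kc : convex_cone K).
Hypothesis K0 : forall z, K z -> 0 <= q z.1 + z.2.

Lemma cone_inf_le x z : K z -> cone_inf q K x <= q (x + z.1) + z.2.
Proof.
move=> Kz; apply: ge_inf; last by exists z.
exists (- q (- x)) => _ [w Kw <-].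
have := qs.1 (x + w.1) (- x); rewrite addrAC subrr add0r => h.
by have := K0 Kw; lra.
Qed.

Lemma le_cone_inf x m :
  (forall z, K z -> m <= q (x + z.1) + z.2) -> m <= cone_inf q K x.
Proof.
move=> h; apply: lb_le_inf.
  by case: Kc => K00 _ _; exists (q (x + 0) + 0), (0, 0).
by move=> _ [z Kz <-]; exact: h.
Qed.

Lemma cone_inf_le_base x : cone_inf q K x <= q x.
Proof.
by case: Kc => K00 _ _; have := cone_inf_le x K00; rewrite !addr0.
Qed.

Lemma cone_infN z : K z -> cone_inf q K (- z.1) <= z.2.
Proof.
by move=> Kz; have := cone_inf_le (- z.1) Kz;
  rewrite addNr (sublinear0 qs) add0r.
Qed.

Lemma sublinear_cone_inf : sublinear (cone_inf q K).
Proof.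
have [K00 KD KZ] := Kc; split.
  move=> x y; rewrite -lerBlDr; apply: le_cone_inf => z Kz.
  rewrite lerBlDl -lerBlDr; apply: le_cone_inf => w Kw.
  rewrite lerBlDr; apply: (le_trans (cone_inf_le _ (KD w z Kw Kz))) => /=.
  have := qs.1 (y + w.1) (x + z.1).
  by rewrite addrACA (addrC y x); lra.
move=> t x; rewrite le_eqVlt => /predU1P[<-|t0].
  by rewrite scale0r mul0r -(sublinear0 qs) cone_inf_le_base.
rewrite -ler_pdivrMl//; apply: le_cone_inf => z Kz.
rewrite ler_pdivrMl// mulrDr.
apply: (le_trans (cone_inf_le _ (KZ _ _ (ltW t0) Kz))) => /=.
by rewrite -scalerDr lerD2r qs.2// ltW.
Qed.

End ConeInf.

(** Zorn's lemma: the pointwise infimum of a nonempty chain is again sublinear, and it is finite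
    because [r x >= - r (- x) >= - p (- x)] for every sublinear [r <= p]. *)
Lemma sublinear_minimal p : sublinear p -> exists q,
  [/\ sublinear q, forall x, q x <= p x &
      forall q', sublinear q' -> (forall x, q' x <= q x) ->
        forall x, q x <= q' x].
Proof.
move=> ps; pose T := {q : V -> R | sublinear q /\ forall x, q x <= p x}.
pose below (s t : T) := `[< forall x, sval t x <= sval s x >].
have [||| [q [qs qp]] qmin] :=
  @ZL_preorder T (exist _ p (conj ps (fun=> lexx _))) below.
- by move=> t; apply/asboolP.
- move=> s r t /asboolP rs /asboolP st; apply/asboolP => x.
  exact: le_trans (st x) (rs x).
- move=> A Atot.
  (* The empty chain is bounded by [p] itself; its pointwise infimum would be the default value
     [0]. *)
  have [[a Aa]|A0] := pselect (A !=set0); last first.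
    exists (exist _ p (conj ps (fun=> lexx _))) => s As.
    by exfalso; apply: A0; exists s.
  pose m x := inf [set sval s x | s in A].
  have lbA x s : A s -> m x <= sval s x.
    move=> As; apply: ge_inf; last by exists s.
    exists (- p (- x)) => _ [[r [rs rp]] _ <-] /=.
    by apply: (le_trans _ (sublinearN _ rs)); rewrite lerN2.
  have glbA x b : (forall s, A s -> b <= sval s x) -> b <= m x.
    move=> h; apply: lb_le_inf; first by exists (sval a x), a.
    by move=> _ [s As <-]; exact: h.
  have ms : sublinear m.
    split.
      move=> x y; rewrite -lerBlDr; apply: (glbA) => s As.
      rewrite lerBlDl -lerBlDr; apply: (glbA) => r Ar; rewrite lerBlDr.
      (* The smaller of [r] and [s] serves at both [x] and [y]. *)
      have [/asboolP rs|/asboolP sr] := Atot _ _ As Ar.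
        apply: (le_trans (lbA _ _ Ar)); case: (svalP r) => -[rD _] _.
        by apply: (le_trans (rD _ _)); rewrite addrC lerD2l.
      apply: (le_trans (lbA _ _ As)); case: (svalP s) => -[sD _] _.
      by apply: (le_trans (sD _ _)); rewrite addrC lerD2r.
    move=> t x; rewrite le_eqVlt => /predU1P[<-|t0].
      rewrite mul0r; apply: (le_trans (lbA _ _ Aa)).
      by rewrite scale0r sublinear0//; case: (svalP a).
    rewrite -ler_pdivrMl//; apply: glbA => s As.
    rewrite ler_pdivrMl//; apply: (le_trans (lbA _ _ As)).
    by case: (svalP s) => -[_ sZ] _; apply/sZ/ltW.
  have mp x : m x <= p x.
    by apply: (le_trans (lbA _ _ Aa)); case: (svalP a).
  by exists (exist _ m (conj ms mp)) => s As; apply/asboolP => x; exact: lbA.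
exists q; split=> // q' qs' qq' x.
have qp' y : q' y <= p y by exact: le_trans (qq' y) (qp y).
have := qmin (exist _ q' (conj qs' qp')).
by move=> /(_ (asboolT qq')) /asboolP; exact.
Qed.

(* If [q] is minimal, replacing it by its infimal convolution along the ray
   [R_+ y] does not decrease it, which says [q x + q y <= q (x + y)]. *)
Lemma hahn_banach p : sublinear p ->
  exists f : {linear V -> R^o}, forall x, f x <= p x.
Proof.
move=> /sublinear_minimal[q [qs qp qmin]].
have qD x y : q (x + y) = q x + q y.
  apply/le_anti; rewrite qs.1/=.
  pose K : set (V * R) := [set (t *: y, - (t * q y)) | t in [set t | 0 <= t]].
  have Kc : convex_cone K.
    split; first by exists 0 => //=; rewrite scale0r mul0r oppr0.
      move=> _ _ [s /= s0 <-] [t /= t0 <-].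
      exists (s + t); first exact: addr_ge0.
      by rewrite scalerDl mulrDl opprD.
    move=> s _ s0 [t /= t0 <-]; exists (s * t); first exact: mulr_ge0.
    by rewrite /= scalerA mulrN mulrA.
  have K0 z : K z -> 0 <= q z.1 + z.2.
    move=> [t /= + <-] /=; rewrite le_eqVlt => /predU1P[<-|t0].
      by rewrite scale0r mul0r oppr0 addr0 sublinear0.
    have := qs.2 t^-1 (t *: y); rewrite invr_ge0 (ltW t0) => /(_ isT).
    rewrite scalerA mulVf ?gt_eqF// scale1r => h.
    by rewrite subr_ge0 -ler_pdivlMl.
  have := qmin _ (sublinear_cone_inf qs Kc K0) (cone_inf_le_base qs Kc K0) x.
  move=> /le_trans/(_ (cone_inf_le qs K0 x (z := (y, - q y)) _)) /=.
  by rewrite lerBrDr; apply; exists 1; rewrite /= ?scale1r ?mul1r.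
have qN x : q (- x) = - q x.
  by apply/eqP; rewrite -addr_eq0 -qD addNr sublinear0.
have qZ0 (t : R) x : 0 < t -> q (t *: x) = t * q x.
  move=> t0; apply/le_anti; rewrite (qs.2 _ _ (ltW t0))/=.
  have := qs.2 t^-1 (t *: x); rewrite invr_ge0 (ltW t0) => /(_ isT).
  by rewrite scalerA mulVf ?gt_eqF// scale1r ler_pdivlMl.
have qlin : linear (q : V -> R^o).
  move=> t x y; rewrite qD; congr (_ + _).
  have [t0|t0|->] := ltrgtP t 0; last by rewrite !scale0r sublinear0.
    by rewrite -[t]opprK scaleNr qN qZ0 ?oppr_gt0// -scaleNr.
  by rewrite qZ0.
pose qM := GRing.isLinear.Build R V R^o *:%R q qlin.
pose f : {linear V -> R^o} := HB.pack q qM.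
by exists f.
Qed.

(** Meant for [K] the epigraph of a multiple of the norm, so that one linear form is dominated both
    by [p] and by that multiple. *)
Lemma hahn_banach_cone p K : sublinear p -> convex_cone K ->
  (forall z, K z -> 0 <= p z.1 + z.2) ->
  exists f : {linear V -> R^o},
    (forall x, f x <= p x) /\ (forall z, K z -> f (- z.1) <= z.2).
Proof.
move=> ps Kc K0; have [f fp] := hahn_banach (sublinear_cone_inf ps Kc K0).
exists f; split=> [x|z Kz]; apply: (le_trans (fp _)).
  exact: cone_inf_le_base.
exact: cone_infN.
Qed.

End Sublinear.

(** * Clarke derivatives *)

Section Clarke.
Context {R : realType} {X : normedModType R}.
Variables (Phi : X -> R) (hPhi : locally_lipschitz Phi).
Implicit Types (x v : X) (a : R).

Lemma locally_lipschitz_bound x :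
  exists K U, [/\ 0 < K, nbhs x U &
    forall y z, U y -> U z -> `|Phi y - Phi z| <= K * `|y - z|].
Proof.
have [U Ux /pinfty_ex_gt0[K K0 HK]] := hPhi x.
by exists K, U; split=> // y z Uy Uz; exact: (HK (y, z)).
Qed.

Lemma locally_lipschitz_continuous : continuous Phi.
Proof.
move=> x; have [K [U [K0 Ux HK]]] := locally_lipschitz_bound x.
apply/cvgrPdist_lt => e e0; near=> y.
apply: (le_lt_trans (HK _ _ (nbhs_singleton Ux) _)); first by near: y.
rewrite -ltr_pdivlMl//; near: y; apply: cvgr_dist_lt => //.
by rewrite mulr_gt0// invr_gt0.
Unshelve. all: by end_near. Qed.

Lemma near_shift x v (U : set X) : nbhs x U ->
  \forall w \near x & t \near (0 : R)^'+, U (w + t *: v).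
Proof.
move=> Ux.
have : (fun p : X * R => p.1 + p.2 *: v)
    @ filter_prod (nbhs x) (nbhs (0 : R)^'+) --> x + 0 *: v.
  apply: cvgD; first exact: cvg_fst.
  apply: cvgZr_tmp.
  by apply: cvg_trans; [exact: cvg_snd|exact: cvg_within].
by rewrite scale0r addr0; apply.
Qed.

Lemma near_right_pos x : \forall w \near x & t \near (0 : R)^'+, 0 < t.
Proof.
by exists (setT, [set t | 0 < t]) => /=;
  [split; [exact: filterT|exact: nbhs_right_gt] | move=> [w t] /= []].
Qed.

(** A division-free substitute for the limsup: it follows from [clarke_derivative Phi x v < a] and
    implies [clarke_derivative Phi x v <= a]. *)
Definition clarke_le x v a : Prop :=
  \forall w \near x & t \near (0 : R)^'+, Phi (w + t *: v) - Phi w <= a * t.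

Lemma clarke_derivative_le x v a :
  clarke_le x v a -> (clarke_derivative Phi x v <= a%:E)%E.
Proof.
move=> H; have H' : filter_prod (nbhs x) (nbhs (0 : R)^'+)
    [set p | Phi (p.1 + p.2 *: v) - Phi p.1 <= a * p.2 /\ 0 < p.2].
  exact: filterI H (near_right_pos x).
apply: (@le_trans _ _ (ereal_sup ((fun p : X * R =>
    ((Phi (p.1 + p.2 *: v) - Phi p.1) / p.2)%:E) @`
    [set p | Phi (p.1 + p.2 *: v) - Phi p.1 <= a * p.2 /\ 0 < p.2]))).
  apply: ereal_inf_lbound.
  by exists [set p | Phi (p.1 + p.2 *: v) - Phi p.1 <= a * p.2 /\ 0 < p.2].
apply: ge_ereal_sup => _ [[w t] /= [h t0] <-].
by rewrite lee_fin ler_pdivrMr.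
Qed.

Lemma clarke_derivative_lt x v a :
  (clarke_derivative Phi x v < a%:E)%E -> clarke_le x v a.
Proof.
move=> /ereal_inf_lt[_ [A FA <-] ltA].
apply: filterS2 FA (near_right_pos x) => -[w t] /= Awt t0.
rewrite -ler_pdivrMr// -lee_fin; apply: (le_trans _ (ltW ltA)).
by apply: ereal_sup_ubound; exists (w, t).
Qed.

(** The neighbourhood of base points that witnesses the bound at [x] also witnesses it at nearby
    points; this is the source of upper semicontinuity in [x]. *)
Lemma near_clarke_le x v a :
  clarke_le x v a -> \forall y \near x, clarke_le y v a.
Proof.
move=> [[U V] /= [Ux V0] UV]; have := near_join Ux.
by apply: filterS => y Uy; exists (U, V).
Qed.

(** The step along [u + v] is split at [w + t *: u], an admissible base point for [v] because
    Clarke's limsup lets the base point vary. *)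
Lemma clarke_leD x u v a b :
  clarke_le x u a -> clarke_le x v b -> clarke_le x (u + v) (a + b).
Proof.
move=> xua [[U V] /= [Ux V0] UV].
have nV : \forall w \near x & t \near (0 : R)^'+, V t.
  by exists (setT, V) => /=; [split=> //; exact: filterT|move=> [w t] []].
apply: filterS3 xua (near_shift u Ux) nV => -[w t] /= h1 Uw Vt.
have /= h2 := UV (w + t *: u, t) (conj Uw Vt).
by rewrite scalerDr addrA mulrDl; lra.
Qed.

Lemma clarke_leZ x v a s :
  0 < s -> clarke_le x v a -> clarke_le x (s *: v) (s * a).
Proof.
move=> s0 [[U V] /= [Ux V0] UV].
have V0s : \forall t \near (0 : R)^'+, V (t * s).
  rewrite near_withinE.
  have : t * s @[t --> (0 : R)] --> 0 * s by apply: cvgMr_tmp; exact: cvg_id.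
  have V0' : \forall t \near (0 : R), 0 < t -> V t by exact: V0.
  rewrite mul0r => /(_ _ V0')/= Vs; near=> t => t0.
  have : 0 < t * s -> V (t * s) by near: t.
  by apply; rewrite mulr_gt0.
exists (U, [set t | V (t * s)]) => // -[w t] /= UVwt.
by have /= := UV (w, t * s) UVwt; rewrite scalerA mulrA mulrAC (mulrC s).
Unshelve. all: by end_near. Qed.

(** A local Lipschitz constant bounds the difference quotients on both sides; hence the
    extended-real limsup is finite. *)
Lemma clarke_le_bounds x : exists2 K, 0 < K &
  forall v, clarke_le x v (K * `|v|) /\
    forall a, clarke_le x v a -> - (K * `|v|) <= a.
Proof.
have [K [U [K0 Ux HK]]] := locally_lipschitz_bound x; exists K => // v.
have H : \forall w \near x & t \near (0 : R)^'+,
    `|Phi (w + t *: v) - Phi w| <= K * `|v| * t /\ 0 < t.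
  have nU : \forall w \near x & t \near (0 : R)^'+, U w.
    by exists (U, setT) => /=; [split=> //; exact: filterT|move=> [w t] []].
  apply: filterS3 nU (near_shift v Ux) (near_right_pos x).
  move=> -[w t] /= Uw Uwt t0.
  split=> //; apply: (le_trans (HK _ _ Uwt Uw)).
  by rewrite addrC addKr normrZ gtr0_norm// -mulrA (mulrC t).
split; first by apply: filterS H => -[w t] /= [/(le_trans (ler_norm _))].
move=> a xva.
have [[w t]/= [[/ler_normlP[h1 _] t0] h2]] := filter_ex (filterI H xva).
rewrite -(ler_pM2r t0); lra.
Qed.

Definition clarkeD x v : R := fine (clarke_derivative Phi x v).

Lemma clarke_derivativeE x v : clarke_derivative Phi x v = (clarkeD x v)%:E.
Proof.
have [K _ /(_ v)[h1 h2]] := clarke_le_bounds x.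
rewrite /clarkeD fineK// fin_real//; apply/andP; split; last first.
  by rewrite (le_lt_trans (clarke_derivative_le h1))// ltry.
rewrite ltNye; apply/eqP => E.
have /h2 : clarke_le x v (- (K * `|v|) - 1).
  by apply: clarke_derivative_lt; rewrite E ltNyr.
lra.
Qed.

Lemma clarkeD_le x v a : clarke_le x v a -> clarkeD x v <= a.
Proof. by move=> /clarke_derivative_le; rewrite clarke_derivativeE lee_fin. Qed.

Lemma clarkeD_lt x v a : clarkeD x v < a -> clarke_le x v a.
Proof.
by move=> h; apply: clarke_derivative_lt; rewrite clarke_derivativeE lte_fin.
Qed.

Lemma sublinear_clarkeD x : sublinear (clarkeD x).
Proof.
split=> [u v|t v].
  apply/ler_addgt0Pr => e e0.
  have -> : clarkeD x u + clarkeD x v + e =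
    (clarkeD x u + e / 2) + (clarkeD x v + e / 2) by lra.
  by apply/clarkeD_le/clarke_leD; apply: clarkeD_lt; lra.
rewrite le_eqVlt => /predU1P[<-|t0].
  rewrite scale0r mul0r; apply: clarkeD_le.
  apply: filterS (near_right_pos x) => -[w s] _ /=.
  by rewrite scaler0 addr0 subrr mul0r.
apply/ler_addgt0Pr => e e0.
have -> : t * clarkeD x v + e = t * (clarkeD x v + e / t).
  by rewrite mulrDr mulrCA divff ?gt_eqF// mulr1.
by apply/clarkeD_le/clarke_leZ => //; apply: clarkeD_lt; rewrite ltrDl divr_gt0.
Qed.

Lemma near_clarkeD_lt x v a :
  clarkeD x v < a -> \forall y \near x, clarkeD y v < a.
Proof.
move=> xva; have := near_clarke_le (@clarkeD_lt x v ((clarkeD x v + a) / 2) _).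
move=> /(_ ltac:(lra)); apply: filterS => y /clarkeD_le; lra.
Qed.

(* The least norm is [sup_(|v| <= 1) - D(x, v)]; it is attained by any linear
   form dominated by both [D(x, .)] and this multiple of the norm. *)
Lemma clarke_gradient_min_norm x : exists m,
  [/\ is_min [set dual_norm f | f in clarke_gradient Phi x] m, 0 <= m &
  forall r, (forall v, `|v| <= 1 -> - r <= clarkeD x v) -> m <= r].
Proof.
have [K K0 HK] := clarke_le_bounds x.
have Ds := sublinear_clarkeD x.
have DK v : clarkeD x v <= K * `|v| by apply: clarkeD_le; case: (HK v).
have DNK v : - clarkeD x v <= K * `|v|.
  by have := sublinearN v Ds; have := DK (- v); rewrite normrN; lra.
pose S := [set - clarkeD x v | v in [set v : X | `|v| <= 1]].
have S0 : S 0 by exists 0; rewrite /= ?normr0// sublinear0// oppr0.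
have supS : has_sup S.
  split; first by exists 0.
  exists K => _ [v /= v1 <-]; apply: (le_trans (DNK v)).
  by rewrite ger_pMr.
pose m := sup S.
have m0 : 0 <= m by exact: sup_upper_bound.
(* By rescaling to the unit sphere. This is the compatibility condition of [hahn_banach_cone] for
   the cone [C] below. *)
have mD v : 0 <= clarkeD x v + m * `|v|.
  have [->|v0] := eqVneq v 0; first by rewrite sublinear0// normr0 mulr0 addr0.
  have nv0 : 0 < `|v| by rewrite normr_gt0.
  have : - clarkeD x (`|v|^-1 *: v) <= m.
    apply: sup_upper_bound => //; exists (`|v|^-1 *: v) => //=.
    by rewrite normrZ normfV normr_id mulVf// gt_eqF.
  have := Ds.2 `|v|^-1 v; rewrite invr_ge0 (ltW nv0) => /(_ isT) h1 h2.
  have : - m <= `|v|^-1 * clarkeD x v by lra.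
  by rewrite ler_pdivlMl// mulrN mulrC; lra.
have gb (g : {linear X -> R^o}) c : (forall v, g v <= c * `|v|) ->
    forall v, `|g v| <= c * `|v|.
  move=> gc v; rewrite ler_norml gc andbT lerNl.
  by have := gc (- v); rewrite linearN normrN.
have has_sup_dual (g : {linear X -> R^o}) : clarke_gradient Phi x g ->
    has_sup [set `|g v| | v in [set v : X | `|v| <= 1]].
  move=> [_ gD]; split; first by exists `|g 0|, 0; rewrite //= normr0.
  exists K => _ [v /= v1 <-]; apply: (@le_trans _ _ (K * `|v|)).
    apply: gb => w; apply: (le_trans _ (DK w)).
    by have := gD w; rewrite clarke_derivativeE lee_fin.
  by rewrite ger_pMr.
have m_lb (g : {linear X -> R^o}) : clarke_gradient Phi x g -> m <= dual_norm g.
  move=> gG; apply: ge_sup; first by exists 0.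
  move=> _ [v /= v1 <-]; apply: (@le_trans _ _ `|g v|).
    apply: (@le_trans _ _ (- g v)); last by rewrite -normrN ler_norm.
    by rewrite lerN2; case: gG => _ /(_ v); rewrite clarke_derivativeE lee_fin.
  by apply: sup_upper_bound; [exact: has_sup_dual|exists v].
(* The epigraph of [m] times the norm: membership of [- w], paired with [m] times the norm of [w],
   will bound [f w]. *)
pose C : set (X * R) := [set z | m * `|z.1| <= z.2].
have Cc : convex_cone C.
  split; rewrite /C /=.
  - by rewrite normr0 mulr0.
  - move=> z w h1 h2; apply: (@le_trans _ _ (m * (`|z.1| + `|w.1|))).
      by rewrite ler_wpM2l// ler_normD.
    by rewrite mulrDr lerD.
  - by move=> t z t0 h; rewrite normrZ (ger0_norm t0) mulrCA ler_wpM2l.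
have [|f [fD fC]] := hahn_banach_cone Ds Cc.
  by move=> [z b] /= h; apply: (le_trans (mD z)); rewrite lerD2l.
have fm v : `|f v| <= m * `|v|.
  apply: gb => w; have := fC (- w, m * `|w|).
  by rewrite /C /= opprK normrN; apply.
have fG : clarke_gradient Phi x f.
  split; last by move=> v; rewrite clarke_derivativeE lee_fin.
  apply/linear_bounded_continuous/linear_boundedP.
  apply: filterS (nbhs_pinfty_ge (num_real m)) => r mr v.
  by apply: (le_trans (fm v)); rewrite ler_wpM2r.
exists m; split=> //.
  split; last by move=> _ [g gG <-]; exact: m_lb.
  exists f => //; apply/le_anti; rewrite m_lb// andbT.
  apply: ge_sup; first by exists `|f 0|, 0; rewrite //= normr0.
  by move=> _ [v /= v1 <-]; apply: (le_trans (fm v)); rewrite ler_piMr.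
move=> r hr; apply: ge_sup; first by exists 0.
by move=> _ [v /= v1 <-]; rewrite lerNl; exact: hr.
Qed.

End Clarke.

(** * Ordering principle and continuous selections *)

(** Each term [u n] is followed by a successor whose [J] is within [1 / (n + 1)] of the infimum over
    all successors. Whatever succeeds the bound [l] succeeds every term, so its [J] cannot be
    smaller than [J l]. *)
Lemma ordering_principle {R : realType} (T : Type) (S : T -> T -> Prop)
    (J : T -> R) (b : R) :
  (forall x, S x x) -> (forall x y z, S x y -> S y z -> S x z) ->
  (forall x y, S x y -> J y <= J x) -> (forall x, b <= J x) ->
  (forall u : nat -> T, (forall n m, (n <= m)%N -> S (u n) (u m)) ->
    exists l, forall n, S (u n) l) ->
  forall x, exists2 l, S x l & forall y, S l y -> J l <= J y.
Proof.
move=> Sxx Strans SJ Jb Schain x.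
have step (p : T * nat) : exists y, S p.1 y /\
    forall z, S p.1 z -> J y <= J z + p.2.+1%:R^-1.
  case: p => y n /=; pose A := [set J z | z in S y].
  have infA : has_inf A.
    by split; [exists (J y), y|exists b => _ [z _ <-]].
  have n0 : 0 < n.+1%:R^-1 :> R by rewrite invr_gt0.
  have [_ [z yz <-] zlt] := inf_adherent n0 infA; exists z; split=> // w yw.
  apply: (le_trans (ltW zlt)); rewrite lerD2r.
  by apply: ge_inf; [case: infA|exists w].
have [f fP] := choice step.
pose u := fix u n := if n is m.+1 then f (u m, m) else x.
have uS n m : (n <= m)%N -> S (u n) (u m).
  move=> nm; rewrite -(subnKC nm).
  elim: (m - n)%N => [|k ih]; first by rewrite addn0.
  rewrite addnS; apply: (Strans _ _ _ ih).
  by case: (fP (u (n + k)%N, (n + k)%N)).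
have [l ul] := Schain u uS; exists l; first exact: (ul 0).
move=> y ly; apply/ler_addgt0Pr => e e0.
have [n _ /(_ n (leqnn n)) /= ne] := near_infty_natSinv_lt (PosNum e0).
apply: (le_trans (SJ _ _ (ul n.+1))).
have [_ /(_ y) h] := fP (u n, n).
apply: (le_trans (h _)); first exact: Strans (ul n) ly.
by rewrite lerD2l ltW.
Qed.

Section Clamp.
Context {R : realType}.
Implicit Types t : R.

(** Composition with [clamp] extends a path on [[0, 1]] by constants, so that continuity can be
    taken on all of [R]. *)
Definition clamp t : R := Num.max 0 (Num.min t 1).

Lemma clamp_ge0 t : 0 <= clamp t.
Proof. by rewrite le_max lexx. Qed.

Lemma clamp_le1 t : clamp t <= 1.
Proof. by rewrite ge_max ler01 ge_min lexx orbT. Qed.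

Lemma clamp_le0 t : t <= 0 -> clamp t = 0.
Proof. by move=> t0; rewrite /clamp max_l// ge_min t0. Qed.

Lemma clamp_ge1 t : 1 <= t -> clamp t = 1.
Proof. by move=> t1; rewrite /clamp min_r// max_r. Qed.

Lemma clamp_id t : 0 <= t <= 1 -> clamp t = t.
Proof. by move=> /andP[t0 t1]; rewrite /clamp min_l// max_r. Qed.

Lemma continuous_clamp : continuous clamp.
Proof.
move=> t; apply: (@continuous_max _ _ (fun=> 0) (fun t => Num.min t 1)).
  exact: cvg_cst.
by apply: (@continuous_min _ _ id (fun=> 1)); [exact: cvg_id|exact: cvg_cst].
Qed.

End Clamp.

(** A selection on [[0, r]] is blended, by convexity, with a constant valid near the supremum [s] of
    the reachable times; this reaches beyond [s] unless [s = 1]. *)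
Lemma continuous_selection {R : realType} {X : normedModType R}
    (G : R -> set X) :
  (forall (t : R) v w (a : R), G t v -> G t w -> 0 <= a <= 1 ->
    G t ((1 - a) *: v + a *: w)) ->
  (forall t : R, 0 <= t <= 1 -> exists v, \forall s \near t, G s v) ->
  exists2 h : R -> X, continuous h & forall t, 0 <= t <= 1 -> G t (h t).
Proof.
move=> Gconv Gloc.
pose A := [set s : R | 0 <= s <= 1 /\
  exists2 h : R -> X, continuous h & forall t, 0 <= t <= s -> G t (h t)].
have A0 : A 0.
  split; first by rewrite lexx ler01.
  have [|v v0] := Gloc 0; first by rewrite lexx ler01.
  exists (fun=> v); first exact: cst_continuous.
  move=> t t0; have -> : t = 0 by apply/le_anti; rewrite andbC.
  exact: nbhs_singleton v0.
have supA : has_sup A by split; [exists 0|exists 1 => s [/andP[]]].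
pose s := sup A.
have s0 : 0 <= s by exact: sup_upper_bound.
have s1 : s <= 1 by apply: ge_sup; [exists 0|move=> r [/andP[]]].
have [|v /nbhs_ballP[e /= e0 sev]] := Gloc s; first by rewrite s0.
have [r [/andP[r0 r1] [h hc hG]] sr] := sup_adherent e0 supA.
have rs : r <= s by apply: sup_upper_bound => //; split; [rewrite r0|exists h].
(* Here [s - e < b < r]: [k] equals [h] up to [b] and [v] from [r] on, and on [[b, r]] both values
   are admissible. *)
pose b := (s - e + r) / 2.
have br : 0 < r - b by rewrite /b; rewrite -/s in sr; lra.
pose phi (t : R) := clamp ((t - b) / (r - b)).
have phic : continuous phi.
  move=> t; apply: (@continuous_comp _ _ _ (fun t => (t - b) / (r - b)) clamp);
    last exact: continuous_clamp.
  by apply: cvgMr_tmp; apply: cvgB; [exact: cvg_id|exact: cvg_cst].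
pose k (t : R) := (1 - phi t) *: h t + phi t *: v.
have kc : continuous k.
  move=> t; apply: cvgD; apply: cvgZ.
  - by apply: cvgB; [exact: cvg_cst|exact: phic].
  - exact: hc.
  - exact: phic.
  - exact: cvg_cst.
pose r' := Num.min 1 (s + e / 2).
have Ar' : A r'.
  split.
    by rewrite le_min ler01 ge_min lexx/= andbT addr_ge0// divr_ge0// ltW.
  exists k => // t /andP[t0]; rewrite le_min => /andP[t1 tse].
  have [tb|bt] := leP t b.
    rewrite /k /phi clamp_le0 ?subr0 ?scale1r ?scale0r ?addr0.
      by apply: hG; rewrite t0; lra.
    by rewrite ler_pdivrMr// mul0r subr_le0.
  have Gv : G t v.
    apply: sev; rewrite /ball/= ltr_norml; rewrite /b -/s in bt sr; lra.
  have [rt|tr] := leP r t.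
    rewrite /k /phi clamp_ge1 ?subrr ?scale1r ?scale0r ?add0r//.
    by rewrite ler_pdivlMr// mul1r lerD2r.
  apply: Gconv => //; first by apply: hG; rewrite t0 ltW.
  by rewrite clamp_ge0 clamp_le1.
have : r' <= s by exact: sup_upper_bound.
rewrite ge_min => /orP[s1'|]; last by lra.
have r'1 : r' = 1 by rewrite /r' min_l//; lra.
by case: Ar' => _ [g gc gG]; exists g => // t t01; apply: gG; rewrite r'1.
Qed.

(** * Spaces of paths *)

Section Dist.
Context {R : realType} {X : normedModType R}.
Implicit Types (x y : X) (H : set X).

Lemma dist_le x y H : H y -> dist x H <= `|x - y|.
Proof. by move=> Hy; apply: ge_inf; [exists 0 => _ [z _ <-]|exists y]. Qed.

Lemma dist_ge0 x H : H !=set0 -> 0 <= dist x H.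
Proof.
by move=> [y Hy]; apply: lb_le_inf; [exists `|x - y|, y|move=> _ [z _ <-]].
Qed.

Lemma dist_lt x H r : H !=set0 -> dist x H < r -> exists2 y, H y & `|x - y| < r.
Proof.
move=> [y Hy] xr; apply: contrapT => h; move: xr; apply/negP; rewrite -leNgt.
apply: lb_le_inf; first by exists `|x - y|, y.
by move=> _ [z Hz <-]; rewrite leNgt; apply/negP => xz; apply: h; exists z.
Qed.

Lemma dist_lipschitz x y H : H !=set0 -> dist x H <= dist y H + `|x - y|.
Proof.
move=> H0; apply/ler_addgt0Pr => e e0.
have [|z Hz zr] := @dist_lt y H (dist y H + e) H0; first by rewrite ltrDl.
apply: (le_trans (dist_le x Hz)); have := ler_distD y x z; lra.
Qed.

Lemma continuous_dist H : H !=set0 -> continuous (dist ^~ H : X -> R).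
Proof.
move=> H0 x; apply/cvgrPdist_lt => e e0; near=> y.
have xy : `|x - y| < e by near: y; exact: cvgr_dist_lt.
rewrite ltr_norml; have := dist_lipschitz x y H0.
by have := dist_lipschitz y x H0; rewrite distrC; lra.
Unshelve. all: by end_near. Qed.

Lemma dist_gt0 x H : closed H -> H !=set0 -> ~ H x -> 0 < dist x H.
Proof.
move=> Hc H0 Hx; rewrite lt_neqAle dist_ge0// andbT eq_sym.
apply/eqP => d0; apply: Hx; apply: Hc => U /nbhs_ballP[e /= e0 xU].
have [|y Hy xy] := @dist_lt x H e H0; first by rewrite d0.
by exists y; split=> //; apply: xU; rewrite -ball_normE.
Qed.

Lemma dist_sub x F H : H !=set0 -> H `<=` F -> dist x F <= dist x H.
Proof.
move=> [y Hy] HF; apply: lb_le_inf; first by exists `|x - y|, y.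
by move=> _ [z Hz <-]; exact/dist_le/HF.
Qed.

End Dist.

(** The image of [[0, 1]] is connected; if it avoided [H], both endpoints would lie in one
    component. *)
Lemma separates_crossing {R : realType} {X : normedModType R} (H : set X)
    (z0 z1 : X) (k : R -> X) : separates H z0 z1 -> continuous k ->
  k 0 = z0 -> k 1 = z1 -> exists2 t, 0 <= t <= 1 & H (k t).
Proof.
move=> [Hc Hz0 Hz1 Hne] kc k0 k1; apply: contrapT => noH; apply: Hne.
apply: same_connected_component.
have : k @` `[0, 1] `<=` connected_component (~` H) z0.
  apply: connected_component_max.
  - by exists 0; rewrite //= in_itv/= lexx ler01.
  - by move=> _ [t /= t01 <-] Ht; apply: noH; exists t.
  - apply: connected_continuous_connected; first exact: segment_connected.
    exact: continuous_subspaceT.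
by apply; exists 1; rewrite //= in_itv/= lexx ler01.
Qed.

Definition path_max {R : realType} {T : Type} (g : T -> R) (k : R -> T) : R :=
  sup [set g (k t) | t in `[0, 1]].

Lemma path_maxP {R : realType} {T : topologicalType} (g : T -> R)
    (k : R -> T) : continuous g -> continuous k ->
  (exists2 t, 0 <= t <= 1 & g (k t) = path_max g k) /\
  forall t, 0 <= t <= 1 -> g (k t) <= path_max g k.
Proof.
move=> gc kc; have [|t] := @EVT_max R (g \o k) 0 1 ler01.
  apply: continuous_subspaceT => t.
  by apply: (continuous_comp (kc t)); exact: gc.
rewrite in_itv/= => t01 tmax.
have ub s : 0 <= s <= 1 -> g (k s) <= path_max g k.
  move=> s01; apply: sup_upper_bound; last by exists s; rewrite //= in_itv.
  split; first by exists (g (k t)), t; rewrite //= in_itv.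
  by exists (g (k t)) => _ [r /= r01 <-]; exact: tmax.
split=> //; exists t => //; apply/le_anti; rewrite ub//=.
apply: ge_sup; first by exists (g (k t)), t; rewrite //= in_itv.
by move=> _ [s /= s01 <-]; exact: tmax.
Qed.

(* Under the order [r * `|k t - k' t| <= path_max g k - path_max g k'] for all
   [t], a monotone sequence is uniformly Cauchy, and its limit is a bound since
   [path_max g] is lower semicontinuous. *)
Lemma path_ekeland {R : realType} {X : completeNormedModType R} (g : X -> R)
    (c : R -> X) (C : set R) (r b : R) :
  continuous g -> continuous c -> 0 < r ->
  (forall k, continuous k -> {in C, k =1 c} -> b <= path_max g k) ->
  exists k, [/\ continuous k, {in C, k =1 c},
    forall t, r * `|c t - k t| <= path_max g c - path_max g k &
    forall k', continuous k' -> {in C, k' =1 c} ->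
      (forall t, r * `|k t - k' t| <= path_max g k - path_max g k') ->
      path_max g k <= path_max g k'].
Proof.
move=> gc cc r0 Jb.
pose T := {k : R -> X | continuous k /\ {in C, k =1 c}}.
pose J (k : T) := path_max g (sval k).
pose S (k k' : T) := forall t, r * `|sval k t - sval k' t| <= J k - J k'.
have [|||||[k [kc kC]] ck kmin] := @ordering_principle R T S J b _ _ _ _ _
  (exist _ c (conj cc (fun t _ => erefl))).
- by move=> k t; rewrite !subrr normr0 mulr0.
- move=> x y z xy yz t; have := lerD (xy t) (yz t).
  rewrite addrA subrK; apply: le_trans.
  by rewrite -mulrDr ler_wpM2l ?(ltW r0)// ler_distD.
- move=> x y /(_ 0) h; rewrite -subr_ge0; apply: le_trans h.
  by rewrite mulr_ge0// ltW.
- by case=> k [kc kC]; exact: Jb.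
- move=> u uS; pose a n := J (u n).
  have aJ n m : (n <= m)%N -> a m <= a n.
    move=> /uS/(_ 0) h; rewrite -subr_ge0; apply: le_trans h.
    by rewrite mulr_ge0// ltW.
  have aL : cvgn a.
    apply: nonincreasing_is_cvgn; first by move=> n m; exact: aJ.
    by exists b => _ [n _ <-]; rewrite /a; case: (u n) => k [kc kC]; exact: Jb.
  pose L := limn a.
  have La n : L <= a n.
    by apply: nonincreasing_cvgn_ge => // p q; exact: aJ.
  have ucvg t : cvgn (fun n => sval (u n) t).
    apply/cauchy_cvgP/cauchy_ballP => e e0.
    have : \forall n \near \oo, `|L - a n| < r * e / 2.
      by apply: cvgr_dist_lt => //; rewrite divr_gt0// mulr_gt0.
    (* From [N] on, all terms lie within [(a N - L) / r < e / 2] of [u N] at time [t]. *)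
    move=> [N _ HN]; pose A := [set sval (u n) t | n in [set n | (N <= n)%N]].
    exists (A, A); first by split; exists N => // n Nn; exists n.
    move=> _ [[n /= Nn <-] [m /= Nm <-]].
    rewrite -ball_normE /= -(ltr_pM2l r0).
    have h1 := uS _ _ Nn t; have h2 := uS _ _ Nm t.
    have := HN N (leqnn N); rewrite distrC ger0_norm ?subr_ge0// => h3.
    have := ler_distD (sval (u N) t) (sval (u n) t) (sval (u m) t).
    rewrite -(ler_pM2l r0) mulrDr; rewrite distrC in h1.
    have := La n; have := La m; rewrite /a in h3 *; lra.
  pose l t := limn (fun n => sval (u n) t).
  (* The order between [u n] and a late [u m], in the limit; the bound is uniform in [t], which
     makes [l] continuous. *)
  have ul n t : r * `|sval (u n) t - l t| <= a n - L.
    apply/ler_addgt0Pr => e e0.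
    have : \forall m \near \oo, `|l t - sval (u m) t| < e / r.
      by apply: cvgr_dist_lt; [exact: ucvg|rewrite divr_gt0].
    move=> [N _ HN]; have nm := leq_maxl n N.
    have := HN _ (leq_maxr n N); rewrite ltr_pdivlMr// mulrC distrC => h1.
    have h2 := uS _ _ nm t; have h3 := La (maxn n N).
    have := ler_distD (sval (u (maxn n N)) t) (sval (u n) t) (l t).
    rewrite -(ler_pM2l r0) mulrDr; rewrite /a in h3 *; lra.
  have aLe e : 0 < e -> exists n, a n - L < e.
    move=> e0.
    have : \forall n \near \oo, `|L - a n| < e by exact: cvgr_dist_lt.
    move=> [N _ /(_ N (leqnn N))]; rewrite distrC ger0_norm ?subr_ge0// => h.
    by exists N.
  have lc : continuous l.
    move=> t; apply/cvgrPdist_lt => e e0.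
    have [|n an] := aLe (r * (e / 3)); first by rewrite mulr_gt0// divr_gt0.
    have lu s : `|sval (u n) s - l s| < e / 3.
      by rewrite -(ltr_pM2l r0); exact: le_lt_trans (ul n s) an.
    have uc : continuous (sval (u n)) by case: (svalP (u n)).
    near=> s.
    have uts : `|sval (u n) t - sval (u n) s| < e / 3.
      by near: s; apply: cvgr_dist_lt; [exact: uc|rewrite divr_gt0].
    have := ler_distD (sval (u n) t) (l t) (l s).
    have := ler_distD (sval (u n) s) (sval (u n) t) (l s).
    by have := lu s; have := lu t; rewrite [`|_ - l t|]distrC; lra.
  have lC : {in C, l =1 c}.
    move=> t Ct; rewrite /l (_ : (fun n => _) = fun=> c t) ?lim_cst//.
    by apply/funext => n; case: (svalP (u n)) => _ ->.
  have Jl : path_max g l <= L.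
    have [[t t01 <-] _] := path_maxP gc lc.
    have : g (sval (u n) t) @[n --> \oo] --> g (l t).
      by apply: continuous_cvg; [exact: gc|exact: ucvg].
    move=> gl; apply: (ler_cvg_to gl aL); apply: nearW => n.
    case: (svalP (u n)) => uc _.
    by have [_] := path_maxP gc uc; apply.
  exists (exist _ l (conj lc lC)) => n t /=.
  by apply: (le_trans (ul n t)); rewrite lerD2l lerN2.
exists k; split=> // k' kc' kC' kk'.
by exact: (kmin (exist _ k' (conj kc' kC'))).
Unshelve. all: by end_near. Qed.

(** * Almost critical points *)

(** Uniformity in the direction as well as the base point comes from the Lipschitz constant [K]: a
    change of direction below [(a - b) / K] costs less than [(a - b) * s], the room left by the
    midpoint [b]. *)
Lemma near_clarke_descent {R : realType} {X : normedModType R} (Phi : X -> R)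
    (x v : X) (a : R) : locally_lipschitz Phi -> clarkeD Phi x v < a ->
  \forall p \near (x, v) & s \near (0 : R)^'+,
    Phi (p.1 + s *: p.2) - Phi p.1 < a * s.
Proof.
move=> hPhi; set b := (clarkeD Phi x v + a) / 2 => xva.
have [|[U V] /= [Ux V0] UV] := @clarkeD_lt _ _ _ hPhi x v b.
  by rewrite /b; lra.
have [K [W [K0 Wx HK]]] := locally_lipschitz_bound hPhi x.
pose c := (a - b) / K.
have c0 : 0 < c by rewrite divr_gt0// /b; lra.
have p1x : (fun q : (X * X) * R => q.1.1)
    @ filter_prod (nbhs (x, v)) (nbhs (0 : R)^'+) --> x.
  by apply: cvg_comp; [exact: cvg_fst|exact: (@cvg_fst _ _ (nbhs x) (nbhs v))].
have p2v : (fun q : (X * X) * R => q.1.2)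
    @ filter_prod (nbhs (x, v)) (nbhs (0 : R)^'+) --> v.
  by apply: cvg_comp; [exact: cvg_fst|exact: (@cvg_snd _ _ (nbhs x) (nbhs v))].
have s0 : (fun q : (X * X) * R => q.2)
    @ filter_prod (nbhs (x, v)) (nbhs (0 : R)^'+) --> (0 : R)^'+.
  exact: cvg_snd.
have s0' : (fun q : (X * X) * R => q.2)
    @ filter_prod (nbhs (x, v)) (nbhs (0 : R)^'+) --> (0 : R).
  by apply: cvg_trans s0 _; exact: cvg_within.
have sv : (fun q : (X * X) * R => q.1.1 + q.2 *: v)
    @ filter_prod (nbhs (x, v)) (nbhs (0 : R)^'+) --> x.
  rewrite -[X in _ --> X]addr0 -(scale0r v).
  by apply: cvgD => //; apply: cvgZr_tmp.
have sp : (fun q : (X * X) * R => q.1.1 + q.2 *: q.1.2)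
    @ filter_prod (nbhs (x, v)) (nbhs (0 : R)^'+) --> x.
  by rewrite -[X in _ --> X]addr0 -(scale0r v); apply: cvgD => //; apply: cvgZ.
near=> q.
have Uq : U q.1.1 by near: q; exact: p1x.
have Vq : V q.2 by near: q; exact: s0.
have q0 : 0 < q.2 by near: q; exact: (s0 _ (nbhs_right_gt 0)).
have W1 : W (q.1.1 + q.2 *: v) by near: q; exact: sv.
have W2 : W (q.1.1 + q.2 *: q.1.2) by near: q; exact: sp.
have qc : `|v - q.1.2| < c by near: q; exact: (cvgr_dist_lt _ _ p2v _ c0).
have h1 := UV (q.1.1, q.2) (conj Uq Vq).
have /ler_normlP[_ h2] := HK _ _ W2 W1.
have h3 : K * `|q.1.1 + q.2 *: q.1.2 - (q.1.1 + q.2 *: v)| < (a - b) * q.2.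
  rewrite opprD addrACA subrr add0r -scalerBr normrZ gtr0_norm// mulrCA.
  by rewrite mulrC ltr_pM2r// -ltr_pdivlMl// mulrC distrC.
have h1' : Phi (q.1.1 + q.2 *: v) - Phi q.1.1 <= b * q.2 := h1.
have -> : a * q.2 = (a - b) * q.2 + b * q.2 by rewrite -mulrDl subrK.
lra.
Unshelve. all: by end_near. Qed.

(** Compactness of [[0, 1]] makes the step [s] uniform. Where the maximum is not attained,
    continuity suffices, since the level [path_max g k + r * s] tends to [path_max g k]. *)
Lemma path_max_descent {R : realType} {X : normedModType R} (g : X -> R)
    (k h : R -> X) (r : R) : continuous g -> continuous k -> continuous h ->
  (forall t : R, 0 <= t <= 1 -> g (k t) = path_max g k ->
    \forall u \near t & s \near (0 : R)^'+,
      g (k u + s *: h u) - g (k u) < r * s) ->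
  exists2 s, 0 < s &
    path_max g (fun t => k t + s *: h t) < path_max g k + r * s.
Proof.
move=> gc kc hc gdesc.
have /compact_near_coveringP/near_covering_withinP cover :=
  @segment_compact R 0 1.
have {}cover : \forall s \near (0 : R)^'+, forall t, 0 <= t <= 1 ->
    g (k t + s *: h t) < path_max g k + r * s.
  suff H : \forall s \near (0 : R)^'+, `[0, 1] `<=`
      (fun t => g (k t + s *: h t) < path_max g k + r * s).
    by apply: filterS H => s hs t t01; apply: hs; rewrite /= in_itv.
  apply: cover => t; rewrite /= in_itv /= => t01.
  have [tmax|tmax] := eqVneq (g (k t)) (path_max g k).
    apply: filterS (gdesc t t01 tmax) => -[u s] /= h1; rewrite in_itv/= => u01.
    have [_ /(_ u u01)] := path_maxP gc kc; lra.
  have gk : g (k t) < path_max g k.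
    by rewrite lt_neqAle tmax; have [_] := path_maxP gc kc; apply.
  have : (fun q : R * R => g (k q.1 + q.2 *: h q.1) - r * q.2)
      @ filter_prod (nbhs t) (nbhs (0 : R)^'+) --> g (k t + 0 *: h t) - r * 0.
    have s0 : (fun q : R * R => q.2)
        @ filter_prod (nbhs t) (nbhs (0 : R)^'+) --> (0 : R).
      by apply: cvg_trans; [exact: cvg_snd|exact: cvg_within].
    apply: cvgB; last exact: cvgMl_tmp.
    apply: continuous_cvg; first exact: gc.
    apply: cvgD; first by apply: continuous_cvg; [exact: kc|exact: cvg_fst].
    by apply: cvgZ => //; apply: continuous_cvg; [exact: hc|exact: cvg_fst].
  rewrite scale0r addr0 mulr0 subr0 => /cvgr_lt/(_ _ gk).
  by apply: filterS => -[u s] /=; rewrite ltrBlDr.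
near (0 : R)^'+ => s; exists s; first by near: s; exact: nbhs_right_gt.
have ksc : continuous (fun t => k t + s *: h t).
  by move=> t; apply: cvgD; [exact: kc|apply: cvgZl_tmp; exact: hc].
(* The new maximum is attained, so the pointwise strict bound passes to it. *)
have [[t t01 <-] _] := path_maxP gc ksc.
by move: t t01; near: s.
Unshelve. all: by end_near. Qed.

Section AlmostCritical.
Context {R : realType} {X : completeNormedModType R}.
Variables (Phi : X -> R) (hPhi : locally_lipschitz Phi).
Variables (z0 z1 : X) (H : set X) (y e : R) (c : R -> X).
Hypotheses (Hsep : separates H z0 z1) (H0 : H !=set0) (e0 : 0 < e).
Hypothesis Hy : forall x, H x -> y <= Phi x.
Hypotheses (z0e : e <= dist z0 H) (z1e : e <= dist z1 H).
Hypotheses (cc : continuous c) (c0 : forall t, t <= 0 -> c t = z0)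
  (c1 : forall t, 1 <= t -> c t = z1).
Hypothesis cy : forall t, 0 <= t <= 1 -> Phi (c t) <= y + e ^+ 2 / 4.

Let bump x := Num.max 0 (e ^+ 2 - e * dist x H).
Let g x := Phi x + bump x.
(** Times at which competing paths are frozen. By [z0e] and [z1e] they include all [t <= 0] and all
    [t >= 1], so endpoints are kept. *)
Let C : set R := [set t | e <= dist (c t) H].

Let bump_ge0 x : 0 <= bump x.
Proof. by rewrite le_max lexx. Qed.

Let bump_le x : bump x <= e ^+ 2.
Proof. by rewrite ge_max sqr_ge0/= gerBl mulr_ge0 ?dist_ge0// ltW. Qed.

Let bump_lip x w : bump x <= bump w + e * `|x - w|.
Proof.
rewrite ge_max addr_ge0 ?bump_ge0 ?mulr_ge0 ?(ltW e0)//=.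
apply: (@le_trans _ _ (e ^+ 2 - e * dist w H + e * `|x - w|)).
  have := dist_lipschitz w x H0; rewrite -(ler_pM2l e0) mulrDr distrC; lra.
by rewrite lerD2r le_max lexx orbT.
Qed.

Let continuous_g : continuous g.
Proof.
move=> x; apply: cvgD; first exact: locally_lipschitz_continuous.
apply: (@continuous_max _ _ (fun=> 0) (fun x => e ^+ 2 - e * dist x H)).
  exact: cvg_cst.
apply: cvgB; first exact: cvg_cst.
by apply: cvgMl_tmp; exact: continuous_dist.
Qed.

(** A competing path still joins [z0] to [z1], hence meets [H], where the bump equals [e ^+ 2]. *)
Let admissible_max (k : R -> X) : continuous k -> {in C, k =1 c} ->
  y + e ^+ 2 <= path_max g k.
Proof.
move=> kc kC.
have k0 : k 0 = z0 by rewrite kC ?c0// inE /C /= c0.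
have k1 : k 1 = z1 by rewrite kC ?c1// inE /C /= c1.
have [t t01 Ht] := separates_crossing Hsep kc k0 k1.
have [_ /(_ t t01)] := path_maxP continuous_g kc; apply: le_trans.
rewrite /g lerD// ?Hy// /bump le_max; apply/orP; right.
have -> : dist (k t) H = 0.
  by apply/le_anti; rewrite dist_ge0// (le_trans (dist_le _ Ht))// subrr normr0.
by rewrite mulr0 subr0.
Qed.

(** The bump has Lipschitz constant [e] and Ekeland's slope is [e / 2]; a descent of [Phi] steeper
    than their sum [3 / 2 * e] beats both. *)
Lemma almost_critical_point : exists x, [/\ dist x H <= 3 / 2 * e,
  y <= Phi x <= y + 5 / 4 * e ^+ 2 &
  forall v, `|v| <= 1 -> - (3 / 2 * e) <= clarkeD Phi x v].
Proof.
have e20 : 0 < e / 2 by rewrite divr_gt0.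
have ee0 : 0 < e ^+ 2 by rewrite exprn_gt0.
have [k [kc kC ck kmin]] := path_ekeland continuous_g cc e20 admissible_max.
set J := path_max g k in ck kmin.
have Jy : y + e ^+ 2 <= J by exact: admissible_max.
(* Together with [Jy], this leaves at most [e ^+ 2 / 4] between the maxima along [c] and [k]. *)
have cJ : path_max g c <= y + 5 / 4 * e ^+ 2.
  have [[t t01 <-] _] := path_maxP continuous_g cc.
  have := cy t01; have := bump_le (c t); rewrite /g; lra.
have JcJ : J <= path_max g c.
  rewrite -subr_ge0; apply: le_trans (ck 0).
  by rewrite mulr_ge0// ltW.
(* On [C] the bump vanishes and [k] equals [c], so [g] stays below [J]. *)
have notC t : 0 <= t <= 1 -> g (k t) = J -> dist (c t) H < e.
  move=> t01 tJ; rewrite ltNge; apply/negP => Ct.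
  have : g (k t) <= y + e ^+ 2 / 4.
    rewrite kC ?inE// /g /bump max_l ?addr0 ?cy//.
    by rewrite subr_le0 expr2 ler_pM2l.
  rewrite tJ; lra.
have kM t : 0 <= t <= 1 -> g (k t) = J ->
    dist (k t) H <= 3 / 2 * e /\ y <= Phi (k t) <= y + 5 / 4 * e ^+ 2.
  move=> t01 tJ; split.
    have := dist_lipschitz (k t) (c t) H0; have := notC _ t01 tJ.
    (* The gap [e ^+ 2 / 4] divided by the slope [e / 2]. *)
    have : `|c t - k t| <= e / 2.
      rewrite -(ler_pM2l e20); apply: (le_trans (ck t)).
      by rewrite expr2 in Jy cJ *; lra.
    by rewrite distrC; lra.
  have := bump_ge0 (k t); have := bump_le (k t).
  by move: tJ; rewrite /g => tJ h1 h2; apply/andP; split; lra.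
apply: contrapT => nocrit.
(* Descent is demanded only at maximum times, which avoid [C] by [notC], so the constraints never
   conflict; each of them is convex in [v]. *)
pose G (t : R) : set X := [set v | [/\ `|v| <= 1, C t -> v = 0 &
  0 <= t <= 1 -> g (k t) = J -> clarkeD Phi (k t) v < - (3 / 2 * e)]].
have gkc : continuous (g \o k).
  by move=> t; apply: (continuous_comp (kc t)); exact: continuous_g.
have Gloc (t : R) : 0 <= t <= 1 -> exists v, \forall s \near t, G s v.
  move=> t01; have [tJ|tJ] := eqVneq (g (k t)) J; last first.
    have gkJ : g (k t) < J.
      by rewrite lt_neqAle tJ; have [_] := path_maxP continuous_g kc; apply.
    have gks : \forall s \near t, g (k s) < J.
      exact: (cvgr_lt _ (gkc t)).
    exists 0; apply: filterS gks => s /= sJ.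
    split; [by rewrite normr0|by []|move=> _ sJ'].
    by rewrite sJ' ltxx in sJ.
  have [v v1 vD] : exists2 v, `|v| <= 1 & clarkeD Phi (k t) v < - (3 / 2 * e).
    apply: contrapT => nov; apply: nocrit; exists (k t).
    have [kH ky] := kM t t01 tJ; split=> // v v1.
    rewrite leNgt; apply/negP => vD.
    by apply: nov; exists v.
  (* The direction [v] stays admissible nearby: [C] is closed, and the Clarke derivative is upper
     semicontinuous in the base point. *)
  have dc : continuous (dist ^~ H \o c : R -> R).
    move=> s; apply: (@continuous_comp _ _ _ c (dist ^~ H)); first exact: cc.
    exact: continuous_dist.
  have nearC : \forall s \near t, dist (c s) H < e.
    exact: (cvgr_lt _ (dc t) _ (notC t t01 tJ)).
  have nearD : \forall s \near t, clarkeD Phi (k s) v < - (3 / 2 * e).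
    exact: (kc t _ (near_clarkeD_lt hPhi vD)).
  exists v; apply: filterS2 nearC nearD => s /= sC sD.
  by split=> //; rewrite /C /= leNgt sC.
have Gconv (t : R) v w (a : R) : G t v -> G t w -> 0 <= a <= 1 ->
    G t ((1 - a) *: v + a *: w).
  move=> [v1 vC vD] [w1 wC wD] /andP[a0 a1]; split.
  + apply: (le_trans (ler_normD _ _)).
    rewrite !normrZ (ger0_norm a0) ger0_norm ?subr_ge0//.
    have := ler_wpM2l a0 w1; have := @ler_wpM2l _ (1 - a) _ _ _ v1.
    by rewrite subr_ge0 => /(_ a1); lra.
  + by move=> Ct; rewrite vC// wC// !scaler0 addr0.
  + move=> t01 tJ; have [DD DZ] := sublinear_clarkeD hPhi (k t).
    apply: (le_lt_trans (DD _ _)).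
    have a1' : 0 <= 1 - a by rewrite subr_ge0.
    have := DZ _ v a1'; have := DZ _ w a0.
    have := vD t01 tJ; have := wD t01 tJ.
    set dv := clarkeD _ _ v; set dw := clarkeD _ _ w => h1 h2 h3 h4.
    (* Strictness comes from [v] if [a = 0] and from [w] otherwise. *)
    have [a00|a00] := eqVneq a 0; first by rewrite a00 in h3 h4 *; lra.
    have : a * dw < a * - (3 / 2 * e).
      by rewrite ltr_pM2l// lt_neqAle eq_sym a00.
    have : (1 - a) * dv <= (1 - a) * - (3 / 2 * e) by rewrite ler_wpM2l// ltW.
    lra.
have [h0 h0c h0G] := continuous_selection Gconv Gloc.
(* The selection is controlled on [[0, 1]] only. Since [0] and [1] belong to [C], the clamped one
   vanishes outside. *)
pose h := h0 \o clamp.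
have hc : continuous h.
  move=> t; apply: (@continuous_comp _ _ _ clamp h0); last exact: h0c.
  exact: continuous_clamp.
have hG t : `|h t| <= 1.
  by have [|? _ _] := h0G (clamp t) _; rewrite ?clamp_ge0 ?clamp_le1.
have hC t : C t -> h t = 0.
  move=> Ct; rewrite /h /=; have [t0|t0] := leP t 0.
    rewrite clamp_le0//; have [|_ + _] := h0G 0; first by rewrite lexx ler01.
    by apply; rewrite /C /= c0.
  have [t1|t1] := leP 1 t.
    rewrite clamp_ge1//; have [|_ + _] := h0G 1; first by rewrite lexx ler01.
    by apply; rewrite /C /= c1.
  rewrite clamp_id ?(ltW t0) ?(ltW t1)//.
  by have [|_ + _] := h0G t; [rewrite (ltW t0) (ltW t1)|apply].
have hD t : 0 <= t <= 1 -> g (k t) = J ->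
    clarkeD Phi (k t) (h t) < - (3 / 2 * e).
  move=> t01; rewrite /h /= clamp_id//; by have [_ _] := h0G t t01; apply.
(* [Phi] falls at a rate above [3 / 2 * e] while the bump rises at a rate of at most [e], as [h] has
   norm at most [1]. *)
have [|s s0 sJ] := @path_max_descent R X g k h (- (e / 2)) continuous_g kc hc.
  move=> t t01 tJ; have D := near_clarke_descent hPhi (hD t t01 tJ).
  have khc : (fun q : R * R => ((k q.1, h q.1), q.2))
      @ filter_prod (nbhs t) (nbhs (0 : R)^'+)
      --> filter_prod (nbhs (k t, h t)) (nbhs (0 : R)^'+).
    have fstcvg (f : R -> X) : continuous f ->
        f q.1 @[q --> filter_prod (nbhs t) (nbhs (0 : R)^'+)] --> f t.
      by move=> fc; apply: continuous_cvg; [exact: fc|exact: cvg_fst].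
    have sndcvg : (fun q : R * R => q.2)
        @ filter_prod (nbhs t) (nbhs (0 : R)^'+) --> (0 : R)^'+.
      exact: cvg_snd.
    exact: (cvg_pair (cvg_pair (fstcvg _ kc) (fstcvg _ hc)) sndcvg).
  have := khc _ D; apply: filterS2 (near_right_pos t) => -[u s] /= s0 h1.
  have := bump_lip (k u + s *: h u) (k u).
  rewrite addrAC subrr add0r normrZ gtr0_norm// => h2.
  have : e * (s * `|h u|) <= e * s by rewrite ler_pM2l// ger_pMr.
  by rewrite /g mulNr; lra.
(* The displacement is at most [s], so the new path succeeds [k] in Ekeland's order and yet has a
   smaller maximum. *)
have := kmin (fun t => k t + s *: h t) _ _ _.
rewrite leNgt => /(_ _ _ _)/negP; apply => //.
- by move=> t; apply: cvgD; [exact: kc|apply: cvgZl_tmp; exact: hc].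
- by move=> t /set_mem Ct; rewrite hC// scaler0 addr0 kC// inE.
- move=> t; rewrite opprD addrA subrr add0r normrN normrZ gtr0_norm//.
  have : e / 2 * (s * `|h t|) <= e / 2 * s by rewrite ler_pM2l// ger_pMr.
  move: sJ; rewrite -/J mulNr; lra.
- by apply: (lt_le_trans sJ); rewrite gerDl mulNr oppr_le0 mulr_ge0// ltW.
Unshelve. all: by end_near. Qed.

End AlmostCritical.

(** * Extension of paths and passage to the limit *)

Lemma continuous_comp_clamp {R : realType} {X : topologicalType} (c : R -> X) :
  {within `[0, 1], continuous c} -> continuous (c \o clamp).
Proof.
move=> /subspace_continuousP cc t U Uc.
have t01 : [set` `[0, 1]] (clamp t) by rewrite /= in_itv/= clamp_ge0 clamp_le1.
have : \forall s \near t, [set` `[0, 1]] (clamp s) -> U (c (clamp s)).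
  exact: (continuous_clamp (cc _ t01 _ Uc)).
by apply: filterS => s; apply; rewrite /= in_itv/= clamp_ge0 clamp_le1.
Qed.

Lemma continuous_line {R : realType} {X : normedModType R} (z0 z1 : X) :
  continuous (fun t : R => z0 + t *: (z1 - z0)).
Proof.
by move=> t; apply: cvgD; [exact: cvg_cst|apply: cvgZr_tmp; exact: cvg_id].
Qed.

(** The infimum is genuine: the segment from [z0] to [z1] provides a value, and [Phi z0] is a lower
    bound since every path starts at [z0]. *)
Lemma minimax_lt {R : realType} {X : normedModType R} (Phi : X -> R)
    (z0 z1 : X) (d : R) : continuous Phi -> 0 < d ->
  exists c : R -> X, [/\ continuous c, forall t, t <= 0 -> c t = z0,
    forall t, 1 <= t -> c t = z1 &
    forall t, 0 <= t <= 1 -> Phi (c t) <= minimax Phi z0 z1 + d].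
Proof.
move=> Phic d0.
set A := [set m | exists2 c, paths z0 z1 c &
  is_max [set Phi (c t) | t in `[0, 1]] m].
have infA : has_inf A.
  split.
    have lc := @continuous_line R X z0 z1.
    have [[t t01 tmax] ub] := path_maxP Phic lc.
    exists (path_max Phi (fun t => z0 + t *: (z1 - z0))).
    exists (fun t => z0 + t *: (z1 - z0)).
      split; [exact: continuous_subspaceT|by rewrite scale0r addr0|].
      by rewrite scale1r addrC subrK.
    split; first by exists t => //; rewrite /= in_itv.
    by move=> _ [s /= + <-]; rewrite in_itv; exact: ub.
  exists (Phi z0) => m [c [_ c0 _] [_]]; apply; exists 0; last by rewrite c0.
  by rewrite /= in_itv/= lexx ler01.
have [m [c [cc c0 c1] [_ cm]] md] := inf_adherent d0 infA.
exists (c \o clamp); split.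
- exact: continuous_comp_clamp.
- by move=> t t0; rewrite /= clamp_le0.
- by move=> t t1; rewrite /= clamp_ge1.
- move=> t t01; rewrite /= clamp_id//; apply: (le_trans _ (ltW md)).
  by apply: cm; exists t; rewrite //= in_itv.
Qed.

Lemma cvg_dist_harmonic {R : realType} (a : nat -> R) (l K : R) :
  (forall n, `|a n - l| <= K * n.+1%:R^-1) -> a n @[n --> \oo] --> l.
Proof.
move=> aK; apply/cvgrPdist_le => e e0.
have : K * n.+1%:R^-1 @[n --> \oo] --> K * 0.
  by apply: cvgMl_tmp; exact: cvg_harmonic.
rewrite mulr0 => K0.
near=> n; rewrite distrC; apply: (le_trans (aK n)).
by near: n; exact: (cvgr_le _ K0).
Unshelve. all: by end_near. Qed.

Unset Implicit Arguments.

Theorem theorem1p9 (R : realType) (X : completeNormedModType R)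
    (Phi : X -> R) (hPhi : locally_lipschitz Phi) (z0 z1 : X) (F : set X)
    (hFc : closed F) (hFb : bounded_set F)
    (hsep : separates (F `&` [set x | minimax Phi z0 z1 <= Phi x]) z0 z1) :
  exists (x : nat -> X) (m : nat -> R),
    [/\ forall n, is_min [set dual_norm f | f in clarke_gradient Phi (x n)]
                         (m n),
        dist (x n) F @[n --> \oo] --> (0 : R),
        Phi (x n) @[n --> \oo] --> minimax Phi z0 z1 &
        (1 + `|x n|) * m n @[n --> \oo] --> (0 : R)].
Proof.
set y := minimax Phi z0 z1 in hsep *; set H := _ `&` _ in hsep.
have Phic := locally_lipschitz_continuous hPhi.
have H0 : H !=set0.
  have [||t _ Ht] := separates_crossing hsep (@continuous_line R X z0 z1).
  - by rewrite scale0r addr0.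
  - by rewrite scale1r addrC subrK.
  - by exists (z0 + t *: (z1 - z0)).
have [Hc Hz0 Hz1 _] := hsep.
(* Positive because [H] is closed and misses both endpoints; [e n <= d] keeps the endpoints where
   the bump vanishes. *)
pose d := Num.min (dist z0 H) (dist z1 H).
have d0 : 0 < d by rewrite lt_min; apply/andP; split; exact: dist_gt0.
pose e n := Num.min d n.+1%:R^-1.
have e0 n : 0 < e n by rewrite lt_min d0 invr_gt0 ltr0n.
have en n : e n <= n.+1%:R^-1 by rewrite ge_min lexx orbT.
have e1 n : e n <= 1 by rewrite (le_trans (en n))// invf_le1 ?ler1n ?ltr0n.
have ed n : e n <= d by rewrite ge_min lexx.
have ex n : exists xm : X * R,
    [/\ is_min [set dual_norm f | f in clarke_gradient Phi xm.1] xm.2,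
      dist xm.1 H <= 3 / 2 * e n, y <= Phi xm.1 <= y + 5 / 4 * e n ^+ 2 &
      0 <= xm.2 <= 3 / 2 * e n].
  have e20 : 0 < e n ^+ 2 / 4 by rewrite divr_gt0// exprn_gt0.
  have [c [cc c0 c1 cy]] := minimax_lt z0 z1 Phic e20.
  have [|||x [xH xy xD]] := @almost_critical_point _ _ _ hPhi z0 z1 H y (e n) c
    hsep H0 (e0 n) _ _ _ cc c0 c1 cy.
  - by move=> x [].
  - by apply: (le_trans (ed n)); rewrite ge_min lexx.
  - by apply: (le_trans (ed n)); rewrite ge_min lexx orbT.
  have [m [mmin m0 /(_ _ xD) me]] := clarke_gradient_min_norm hPhi x.
  by exists (x, m); rewrite /= m0.
have [xm xmP] := choice ex.
exists (fst \o xm), (snd \o xm); split=> /=.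
- by move=> n; case: (xmP n).
- apply: (@cvg_dist_harmonic _ _ _ (3 / 2)) => n.
  have [_ xH _ _] := xmP n; have en' := en n.
  have HF : H `<=` F by move=> x [].
  rewrite /= subr0 ger0_norm; last first.
    by apply: dist_ge0; case: H0 => x /HF; exists x.
  move: n.+1%:R^-1 en' (dist_sub (xm n).1 H0 HF) => r; lra.
- apply: (@cvg_dist_harmonic _ _ _ (5 / 4)) => n.
  have [_ _ /andP[xy1 xy2] _] := xmP n; have := en n.
  have : e n ^+ 2 <= e n by rewrite expr2 ger_pMr.
  rewrite /= ger0_norm ?subr_ge0//; move: n.+1%:R^-1 => r; lra.
(* As [e n <= 1], the point [x n] is within [2] of a point of [F], so its norm is at most [M + 2];
   the factor [M + 5] leaves room. *)
- have [M M0 FM] := pinfty_ex_gt0 hFb.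
  apply: (@cvg_dist_harmonic _ _ _ ((M + 5) * (3 / 2))) => n.
  have [_ xH _ /andP[m0 me]] := xmP n.
  have [|z [Fz _] xz] := @dist_lt _ _ (xm n).1 H 2 H0.
    by have := e1 n; lra.
  have zM : `|z| <= M := FM _ Fz.
  have xM : `|(xm n).1| <= M + 2.
    by have := ler_normD ((xm n).1 - z) z; rewrite subrK; lra.
  rewrite subr0 ger0_norm ?mulr_ge0 ?addr_ge0// -mulrA.
  apply: ler_pM; rewrite ?addr_ge0//; first by lra.
  by move: n.+1%:R^-1 (en n) => r; lra.
Qed.
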